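(* Let $\varepsilon>0$ be fixed, and let $G_{n,p}$ be an Erdős–Rényi graph with parameters $n$ and $p=p(n)\in[0,1]$. If $$p\ge\left(\frac{(3+\varepsilon)\log n}{n}\right)^{1/3},$$ then $G_{n,p}$ is diagonal asymptotically almost surely.
   Context: The Erdős–Rényi graph $G_{n,p}$ is the random graph on $n$ labelled vertices in which each pair of distinct vertices is joined by an edge independently with probability $p$; $p=p(n)$ may depend on $n$. A property holds asymptotically almost surely if its probability tends to $1$ as $n\to\infty$. A graph means a finite simple undirected graph without loops. In a graph $G$ with vertex set $V(G)$, let $d(x,y)$ be the length of a shortest path between $x$ and $y$ ($\infty$ if there is none), and $L(x_0,\dots,x_k)=\sum_{i=1}^k d(x_{i-1},x_i)$. For integers $k,\ell\ge 0$, $\mathrm{MC}_{k,\ell}(G)$ is the free $\mathbb{Z}$-module generated by the tuples $(x_0,\dots,x_k)\in V(G)^{k+1}$ with $x_{i-1}\ne x_i$ for all $1\le i\le k$ and $L(x_0,\dots,x_k)=\ell$; $\mathrm{MC}_{-1,\ell}(G)=0$. The boundary map $\partial_{k,\ell}:\mathrm{MC}_{k,\ell}(G)\to\mathrm{MC}_{k-1,\ell}(G)$ is given for $k\ge1$ by $\partial_{k,\ell}(x_0,\dots,x_k)=\sum_{i} (-1)^i (x_0,\dots,\hat{x}_i,\dots,x_k)$, the sum over those $1\le i\le k-1$ with $d(x_{i-1},x_{i+1})=d(x_{i-1},x_i)+d(x_i,x_{i+1})$ (the hat means deletion), and $\partial_{0,\ell}=0$. The magnitude homology is $\mathrm{MH}_{k,\ell}(G)=\ker\partial_{k,\ell}/\mathrm{Im}\,\partial_{k+1,\ell}$.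 A graph $G$ is diagonal if $\mathrm{MH}_{k,\ell}(G)=0$ for all $k\ne\ell$. *)

(* Defs.v *)
From HB Require Import structures.
From mathcomp Require Import all_boot all_order all_algebra.
From mathcomp Require Import boolp.
From mathcomp Require Import reals.

Set Implicit Arguments.
Unset Strict Implicit.
Unset Printing Implicit Defensive.

Import Order.TTheory GRing.Theory Num.Theory.
Local Open Scope ring_scope.

(* A finite simple graph on V is its edge set, a set of 2-element subsets
   of V. *)
Record sgraph (V : finType) := SGraph {
  edges :> {set {set V}};
  _ : [forall e in edges, #|e| == 2] }.

HB.instance Definition _ V := [isSub for @edges V].
HB.instance Definition _ V := [Finite of sgraph V by <:].

Definition adj (V : finType) (G : sgraph V) : rel V :=
  fun x y => [set x; y] \in edges G.

Definition has_path (V : finType) (G : sgraph V) (x y : V) (m : nat) : bool :=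
  [exists t : m.-tuple V,
    [&& path (adj G) x t, last x t == y & uniq (x :: t)]].

(* The type option nat stands for the natural numbers extended by infinity,
   with None for infinity. *)
Definition addo (a b : option nat) : option nat :=
  if a is Some m then if b is Some n then Some (m + n)%N else None else None.

(* A path has fewer than #|V| edges, so the first admissible length in
   0, ..., #|V| - 1 is the least one. *)
Definition dist (V : finType) (G : sgraph V) (x y : V) : option nat :=
  ohead [seq m <- iota 0 #|V| | has_path G x y m].

Fixpoint len_from (V : finType) (G : sgraph V) (x : V) (s : seq V) :
    option nat :=
  if s is y :: s' then addo (dist G x y) (len_from G y s') else Some 0%N.

(* For s = (x_0, ..., x_k): the x_(i-1) and x_i are distinct, and L(s) = l.
   The empty sequence is excluded. *)
Definition is_gen (V : finType) (G : sgraph V) (l : nat) (s : seq V) : bool :=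
  if s is x :: s' then
    path (fun y z => y != z) x s' && (len_from G x s' == Some l)
  else false.

(* Indexed by the number m = k + 1 of vertices, so that the case m = 0 is
   MC_(-1,l) = 0.  There are finitely many generators, so the free Z-module
   on them consists of all the functions from generators to int. *)
Definition gen (V : finType) (G : sgraph V) (m l : nat) : finType :=
  {t : m.-tuple V | is_gen G l t}.

Definition MC (V : finType) (G : sgraph V) (m l : nat) : zmodType :=
  {ffun gen G m l -> int}.

(* Equal to 0 if s is not a generator.  That case does not occur in
   boundary_gen at a generator t: by the condition on i, the deletion has the
   same length l and distinct consecutive entries. *)
Definition basis_elt (V : finType) (G : sgraph V) (m l : nat) (s : seq V) :
    MC G m l :=
  [ffun y : gen G m l => (tval (val y) == s)%:R].

Definition delete (T : Type) (i : nat) (s : seq T) : seq T :=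
  take i s ++ drop i.+1 s.

Definition boundary_gen (V : finType) (G : sgraph V) (k l : nat)
    (t : k.+1.-tuple V) : MC G k l :=
  let x := nth (thead t) t in
  \sum_(1 <= i < k | dist G (x i.-1) (x i.+1) ==
                     addo (dist G (x i.-1) (x i)) (dist G (x i) (x i.+1)))
    basis_elt G k l (delete i t) *~ (-1) ^+ i.

(* The map from MC_(k,l) = MC G k.+1 l to MC_(k-1,l) = MC G k l. *)
Definition boundary (V : finType) (G : sgraph V) (k l : nat)
    (c : MC G k.+1 l) : MC G k l :=
  \sum_(t : gen G k.+1 l) boundary_gen G l (val t) *~ c t.

Lemma boundary_is_zmod_morphism (V : finType) (G : sgraph V) (k l : nat) :
  zmod_morphism (@boundary V G k l).
Proof.
move=> c d; rewrite /boundary -sumrB; apply: eq_bigr => t _.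
by rewrite !ffunE mulrzBr.
Qed.

HB.instance Definition _ (V : finType) (G : sgraph V) (k l : nat) :=
  GRing.isZmodMorphism.Build _ _ (@boundary V G k l)
    (@boundary_is_zmod_morphism V G k l).

Definition cycle_pred (V : finType) (G : sgraph V) (k l : nat) :
    {pred MC G k.+1 l} :=
  fun c => boundary c == 0.

Lemma cycle_zmod_closed (V : finType) (G : sgraph V) (k l : nat) :
  zmod_closed (@cycle_pred V G k l).
Proof.
split=> [|c d]; rewrite /in_mem /= /cycle_pred ?raddf0 //.
by move=> /eqP cK /eqP dK; rewrite raddfB /= cK dK subrr.
Qed.

HB.instance Definition _ (V : finType) (G : sgraph V) (k l : nat) :=
  GRing.isZmodClosed.Build _ (@cycle_pred V G k l)
    (@cycle_zmod_closed V G k l).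

Record cycles (V : finType) (G : sgraph V) (k l : nat) := Cycles {
  cycle_val :> MC G k.+1 l;
  _ : cycle_val \in @cycle_pred V G k l }.

HB.instance Definition _ (V : finType) (G : sgraph V) (k l : nat) :=
  [isSub for @cycle_val V G k l].
HB.instance Definition _ (V : finType) (G : sgraph V) (k l : nat) :=
  [Choice of cycles G k l by <:].
HB.instance Definition _ (V : finType) (G : sgraph V) (k l : nat) :=
  [SubChoice_isSubZmodule of cycles G k l by <:].

(* The image of MC_(k+1,l), viewed inside the kernel. *)
Definition bound_pred (V : finType) (G : sgraph V) (k l : nat) :
    {pred cycles G k l} :=
  fun z => `[< exists c : MC G k.+2 l, boundary c = val z >].

Lemma bound_zmod_closed (V : finType) (G : sgraph V) (k l : nat) :
  zmod_closed (@bound_pred V G k l).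
Proof.
split=> [|y z]; rewrite /in_mem /= /bound_pred.
  by apply/asboolP; exists 0; rewrite [LHS]raddf0 [RHS]raddf0.
move=> /asboolP[c cE] /asboolP[d dE]; apply/asboolP; exists (c - d).
by rewrite [LHS]raddfB [RHS]raddfB /= cE dE.
Qed.

HB.instance Definition _ (V : finType) (G : sgraph V) (k l : nat) :=
  GRing.isZmodClosed.Build _ (@bound_pred V G k l)
    (@bound_zmod_closed V G k l).

Definition MH (V : finType) (G : sgraph V) (k l : nat) : zmodType :=
  Quotient.quot (@bound_pred V G k l).

Definition diagonal_graph (V : finType) (G : sgraph V) : Prop :=
  forall k l : nat, k <> l -> forall h : MH G k l, h = 0.

Definition er_weight (R : realType) (n : nat) (p : R) (G : sgraph 'I_n) : R :=
  \prod_(e : {set 'I_n} | #|e| == 2) (if e \in edges G then p else 1 - p).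

Definition er_prob (R : realType) (n : nat) (p : R)
    (P : sgraph 'I_n -> Prop) : R :=
  \sum_(G : sgraph 'I_n | `[< P G >]) er_weight p G.

(* Main.v *)
Require Import Defs.
From mathcomp Require Import all_boot all_order all_algebra.
From mathcomp Require Import all_classical all_reals all_analysis.
From mathcomp Require Import lra zify ring.

(* By a union bound over triples, the probability that some three vertices have
   no common neighbour is at most n^3 (1 - p^3)^(n-3) <= n^(-eps/2) for large n.
   It remains to see that a graph in which any three vertices have a common
   neighbour is diagonal.  All distances are then at most 2, so an off-diagonal
   cycle consists of tuples with a step of length 2.  By induction on the
   length of the tail, a cycle can be changed by a boundary so that the first
   step of each of its tuples (x, z, ...) has length 2; inserting a common
   neighbour of x and z after x then bounds it, up to an error of shorter tails
   that is again a cycle whose first steps have length 2.  Choosing the inserted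
   vertex adjacent also to the predecessor of x keeps the correction of this
   error from creating new terms. *)

Set Implicit Arguments.
Unset Strict Implicit.

Import Order.TTheory GRing.Theory Num.Theory.
Import numFieldNormedType.Exports.
Local Open Scope classical_set_scope.
Local Open Scope ring_scope.

(** * Exactness of the complex of tails *)

Section TailComplex.
Variables (V : finType) (a : rel V).

(** When all distances are at most 2 and consecutive entries are distinct, [y] lies on a shortest
    path from [x] to [z] only as 1 + 1 = 2. *)
Definition midpoint (x y z : V) : bool :=
  [&& a x y, a y z, x != z & ~~ a x z].

(* A chain of tuples starting at x is encoded by its coefficient function on
   tails.  The coefficient of the boundary at a tail is then a finite sum over
   the insertions into that tail, so no finiteness of the support is needed. *)
Fixpoint bd (x : V) (c : seq V -> int) (s : seq V) : int :=
  if s is z :: s' then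
    - (\sum_(y | midpoint x y z) c (y :: z :: s')) - bd z (fun r => c (z :: r)) s'
  else 0.

Lemma eq_bd x c d s : c =1 d -> bd x c s = bd x d s.
Proof. by move=> /funext ->. Qed.

Lemma bd_sum (I : finType) (P : pred I) (F : I -> seq V -> int) x s :
  bd x (fun r => \sum_(i | P i) F i r) s = \sum_(i | P i) bd x (F i) s.
Proof.
elim: s x F => [|z s IHs] x F /=; first by rewrite big1.
by rewrite (IHs z (fun i r => F i (z :: r))) exchange_big sumrB sumrN.
Qed.

Lemma bdD c d x s : bd x (fun r => c r + d r) s = bd x c s + bd x d s.
Proof.
elim: s x c d => [|z s IHs] x c d /=; first by rewrite addr0.
rewrite (IHs z (fun r => c (z :: r))) big_split /=; ring.
Qed.

Lemma bdZ m c x s : bd x (fun r => m * c r) s = m * bd x c s.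
Proof.
elim: s x c => [|z s IHs] x c /=; first by rewrite mulr0.
by rewrite (IHs z (fun r => c (z :: r))) -mulr_sumr mulrBr mulrN.
Qed.

Lemma bdN c x s : bd x (fun r => - c r) s = - bd x c s.
Proof. by rewrite -mulN1r -bdZ; apply: eq_bd => r; rewrite mulN1r. Qed.

Lemma bd_if (b : bool) c x s :
  bd x (fun r => if b then c r else 0) s = if b then bd x c s else 0.
Proof.
case: b => //; rewrite -[RHS](mul0r (bd x (fun=> 0) s)) -bdZ.
by apply: eq_bd => r; rewrite mul0r.
Qed.

Lemma bd0 x s : bd x (fun=> 0) s = 0.
Proof. exact: (bd_if false (fun=> 0)). Qed.

Hypothesis common : forall u x z, exists w, [&& a u w, a x w & a w z].

(* The vertex u stands for the predecessor of x: when all the tails of e start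
   at a neighbour of u, the vertex x cannot be deleted from u, x, e. *)
Lemma long_first_step_exact n u x c :
  (forall s, bd x c s = 0) ->
  (forall s, c s != 0 -> (size s <= n)%N) ->
  (forall s, c s != 0 -> if s is z :: _ then (x != z) && ~~ a x z else false) ->
  exists e, [/\ forall s, bd x e s = c s,
    forall s, e s != 0 -> (size s <= n.+1)%N &
    forall s, e s != 0 -> if s is y :: _ then a x y && a u y else false].
Proof.
elim: n u x c => [|n IHn] u x c c_cyc c_size c_long.
  exists (fun=> 0); split=> s; rewrite ?eqxx // bd0.
  by apply/eqP; rewrite eq_sym; apply/negPn/negP => cN0;
    move: (c_size _ cN0) (c_long _ cN0); case: s {cN0}.
have [w wP] := choice (fun z => common u x z).
have c0 z s : ~~ ((x != z) && ~~ a x z) -> c (z :: s) = 0.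
  by move=> zN; apply/eqP/negPn; apply: contra zN => /c_long.
have c_nil : c [::] = 0 by apply/eqP/negPn/negP => /c_long.
(* An insertion between [x] and [z] creates a short first step, where [c] vanishes; only the
   boundary of the rest remains. *)
have tail_cyc z s : bd z (fun r => c (z :: r)) s = 0.
  have := c_cyc (z :: s); rewrite /= big1 ?subr0 ?oppr0 ?sub0r.
    by move=> /eqP; rewrite oppr_eq0 => /eqP.
  by move=> y /and4P[xy _ _ _]; rewrite c0 // xy andbF.
(* e0 inserts w z between x and z.  Its boundary is - c up to the tails F
   where z is deleted; e1 removes this error. *)
pose e0 s := if s is y :: z :: r then if y == w z then c (z :: r) else 0 else 0.
pose F y s := if s is q :: r then
  \sum_(z | (y == w z) && midpoint y z q) c (z :: q :: r) else 0.
have e0_bd y s : bd y (fun r => e0 (y :: r)) s = - F y s.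
  case: s => [|q r] /=; first by rewrite oppr0.
  rewrite -big_mkcondr/=.
  rewrite (bd_if (y == w q) (fun r => c (q :: r))) tail_cyc if_same subr0.
  by congr (- _); apply: eq_bigl => z; rewrite andbC.
have e0_bdx z s : bd x e0 (z :: s) = F z s - c (z :: s).
  rewrite /= e0_bd opprK addrC; congr (_ - _).
  have [zN|/c0 ->] := boolP ((x != z) && ~~ a x z); last first.
    by rewrite big1 // => y _; rewrite if_same.
  rewrite -big_mkcondr (big_pred1 (w z)) // => y /=.
  have [->|] := eqVneq y (w z); last by rewrite andbF.
  by rewrite andbT /midpoint; case/and3P: (wP z) => _ -> ->.
(* Nothing is inserted right after [y], because all tails of [F y] have a long first step. As [z q]
   is an edge, [tail_cyc] at [z] passes on to the tails behind [q]. *)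
have F_cyc y s : bd y (F y) s = 0.
  case: s => [//|q r] /=.
  rewrite big1 ?oppr0 ?sub0r; last first.
    move=> v /and4P[yv _ _ _]; rewrite big1 // => z /andP[_ /and4P[_ _ _]].
    by rewrite yv.
  apply/eqP; rewrite oppr_eq0; apply/eqP.
  rewrite (bd_sum _ (fun z r => c (z :: q :: r))) big1 // => z /andP[_ yzq].
  have := tail_cyc z (q :: r); rewrite /= big1 ?oppr0 ?sub0r.
    by move=> /eqP; rewrite oppr_eq0 => /eqP.
  move=> v /and4P[_ _ _ /negP[]]; by case/and4P: yzq.
have F_supp y s : F y s != 0 -> exists z q r,
    [/\ s = q :: r, y = w z, midpoint y z q & c (z :: q :: r) != 0].
  case: s => [|q r] //=.
  move=> FN0; have [z] : exists z,
      ((y == w z) && midpoint y z q) && (c (z :: q :: r) != 0).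
    apply/existsP; apply: contraNT FN0 => /existsPn nz.
    by apply/eqP; rewrite big1 // => z zP; have := nz z; rewrite zP /= negbK => /eqP.
  by move=> /andP[/andP[/eqP -> ?] ?]; exists z, q, r.
(* Here [x] is the predecessor of [y], so the tails of [E y] start at neighbours of [x]. *)
have /choice[E EP] : forall y, exists Ey, [/\ forall s, bd y Ey s = F y s,
      forall s, Ey s != 0 -> (size s <= n.+1)%N &
      forall s, Ey s != 0 -> if s is q :: _ then a y q && a x q else false].
  move=> y; apply: IHn => [//|s /F_supp|s /F_supp] [z [q [r [-> _ yzq cN0]]]].
    exact: c_size cN0.
  by case/and4P: yzq => _ _ -> ->.
have E_bd y s : bd y (E y) s = F y s by case: (EP y).
have E_size y s : E y s != 0 -> (size s <= n.+1)%N by case: (EP y) => _ + _; apply.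
have E_first y z s : E y (z :: s) != 0 -> a y z && a x z.
  by case: (EP y) => _ _ /(_ (z :: s)).
pose e1 s := if s is y :: r then if a x y && a u y then E y r else 0 else 0.
(* The condition on [y] in [e1] loses nothing, since [F y] is nonzero only if [y] is a chosen common
   neighbour. No insertion after [x] contributes, since [E y] starts at neighbours of [x]. *)
have e1_bd z s : bd x e1 (z :: s) = - F z s.
  rewrite /= big1 ?oppr0 ?sub0r.
    rewrite (bd_if _ (E z)); rewrite E_bd.
    case: ifP => // good; congr (- _); apply/esym/eqP/negPn/negP.
    move=> /F_supp[z' [q [r [_ zE _ _]]]]; move: good; rewrite zE.
    by case/and3P: (wP z') => -> ->.
  move=> y /and4P[_ _ _ xz]; case: ifP => // _.
  by apply/eqP/negPn/negP => /E_first; rewrite (negPf xz) andbF.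
exists (fun r => - (e0 r + e1 r)); split.
- case=> [|z s]; first by rewrite c_nil.
  by rewrite bdN bdD e0_bdx e1_bd; ring.
- move=> s; apply: contra_neqT => sN.
  rewrite /e0 /e1; case: s sN => [|y [|z r]] //=; rewrite ?addr0 ?oppr0 //.
  rewrite !ltnS -ltnNge => sz.
  have -> : c (z :: r) = 0.
    by apply/eqP/negPn/negP => /c_size /=; lia.
  suff -> : E y (z :: r) = 0 by rewrite !if_same addr0 oppr0.
  by apply/eqP/negPn/negP => /E_size /=; lia.
- move=> s; apply: contra_neqT => sN.
  rewrite /e0 /e1; case: s sN => [|y r] /=; first by rewrite addr0 oppr0.
  move=> sN; rewrite (negPf sN); case: r => [|z r]; rewrite ?addr0 ?oppr0 //.
  case: eqP => [yE|_]; last by rewrite oppr0.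
  by move: sN; rewrite yE; case/and3P: (wP z) => -> ->.
Qed.

(** The tails behind a short first step [x y] again form a cycle, as nothing can be inserted into an
    edge, and they still contain a nonadjacent step. Induction on [n] fills them by [E y]; what is
    left starts with a long step. *)
Lemma off_diagonal_exact n x c :
  (forall s, bd x c s = 0) ->
  (forall s, c s != 0 -> (size s <= n)%N) ->
  (forall s, c s != 0 -> path (fun y z => y != z) x s && ~~ path a x s) ->
  exists e, (forall s, bd x e s = c s) /\
    (forall s, e s != 0 -> (size s <= n.+1)%N).
Proof.
elim: n x c => [|n IHn] x c c_cyc c_size c_off.
  exists (fun=> 0); split=> s; rewrite ?eqxx // bd0.
  apply/eqP; rewrite eq_sym; apply/negPn/negP => cN0.
  by move: (c_size _ cN0) (c_off _ cN0); case: s {cN0}.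
have c_nil : c [::] = 0 by apply/eqP/negPn/negP => /c_off.
have /choice[E EP] : forall y, exists Ey,
      (forall s, bd y Ey s = if a x y then c (y :: s) else 0) /\
      (forall s, Ey s != 0 -> (size s <= n.+1)%N).
  move=> y; apply: IHn.
  - move=> s; rewrite (bd_if _ (fun r => c (y :: r))); case: ifP => // xy.
    have := c_cyc (y :: s); rewrite /= big1 ?oppr0 ?sub0r.
      by move=> /eqP; rewrite oppr_eq0 => /eqP.
    by move=> v /and4P[_ _ _]; rewrite xy.
  - by move=> s; case: ifP => [_ /c_size|_]; rewrite ?eqxx.
  - by move=> s; case: ifP => [xy /c_off|_]; rewrite ?eqxx //= xy /= => /andP[/andP[_ ->]].
(* Adding the boundary of e1 to c leaves only tails with a long first step. *)
pose e1 s := if s is y :: r then if a x y then E y r else 0 else 0.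
pose c' s := c s + bd x e1 s.
have e1_bd z s : bd x e1 (z :: s) =
    - \sum_(y | midpoint x y z) E y (z :: s) - (if a x z then c (z :: s) else 0).
  rewrite /= (bd_if _ (E z)); case: (EP z) => -> _; congr (- _ - _); last first.
    by case: (a x z).
  by apply: eq_bigr => y /and4P[->].
have c'_long s : c' s != 0 -> if s is z :: _ then (x != z) && ~~ a x z else false.
  apply: contra_neqT; rewrite /c'; case: s => [|z s]; first by rewrite c_nil.
  rewrite e1_bd => zN; rewrite big1 ?oppr0 ?sub0r; last first.
    by move=> y /and4P[_ _ xz axz]; rewrite xz axz in zN.
  case: ifP => axz; first exact: subrr.
  rewrite subr0; apply/eqP/negPn/negP => /c_off /=.
  by move: zN; rewrite axz andbT => /negPf ->.
have c'_cyc s : bd x c' s = 0.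
  case: s => [//|z s] /=; rewrite big1 ?oppr0 ?sub0r; last first.
    move=> y /and4P[axy _ _ _]; apply/eqP/negPn/negP => /c'_long.
    by rewrite axy andbF.
  apply/eqP; rewrite oppr_eq0.
  have [long|short] := boolP ((x != z) && ~~ a x z); last first.
    apply/eqP; rewrite -[RHS](bd0 z s); apply: eq_bd => r.
    by apply/eqP/negPn; apply: contra short => /c'_long.
  have /andP[_ /negPf axz] := long.
  rewrite (_ : bd z _ s = bd z (fun r => c (z :: r) +
      - \sum_(y | midpoint x y z) E y (z :: r)) s); last first.
    by apply: eq_bd => r; rewrite /c' e1_bd axz subr0.
  (* The cycle condition turns the boundary of [c] behind [z] into minus the sum of the
     [c (y :: z :: s)] over midpoints [y]. As [y z] is an edge, each of these is minus the boundary
     of [E y] behind [z], so everything cancels. *)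
  rewrite bdD bdN (bd_sum _ (fun y r => E y (z :: r))).
  have /eqP := c_cyc (z :: s).
  rewrite /= subr_eq0 eq_sym => /eqP ->.
  rewrite -opprD oppr_eq0 -big_split big1 //= => y /and4P[axy ayz _ _].
  have /= := (EP y).1 (z :: s); rewrite axy => <-.
  rewrite big1 ?oppr0 ?sub0r ?addNr // => v /and4P[_ _ _].
  by rewrite ayz.
have c'_size s : c' s != 0 -> (size s <= n.+1)%N.
  apply: contra_neqT; rewrite -ltnNge /c' => sz.
  have -> : c s = 0 by apply/eqP/negPn/negP => /c_size; lia.
  case: s sz => [//|z s] sz; rewrite e1_bd big1 ?oppr0 ?add0r; last first.
    by move=> y _; apply/eqP/negPn/negP => /(EP y).2; lia.
  suff -> : c (z :: s) = 0 by rewrite if_same oppr0.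
  by apply/eqP/negPn/negP => /c_size; lia.
(* There is no predecessor at the start of the tuple, so [x] itself is taken for [u]. *)
have [e2 [e2_bd e2_size _]] := long_first_step_exact x c'_cyc c'_size c'_long.
exists (fun r => e2 r + - e1 r); split=> [s|s].
  by rewrite bdD bdN e2_bd /c' addrK.
apply: contra_neqT; rewrite -ltnNge => sz.
have -> : e2 s = 0 by apply/eqP/negPn/negP => /e2_size; lia.
rewrite /e1; case: s sz => [|z s] sz; rewrite ?subr0 //.
suff -> : E z s = 0 by rewrite if_same subr0.
by apply/eqP/negPn/negP => /(EP z).2; move: sz => /=; lia.
Qed.

End TailComplex.

(** * Diagonality from common neighbours *)

Section CommonNeighbours.

Variables (V : finType) (G : sgraph V).

Lemma adjC x y : adj G x y = adj G y x.
Proof. by rewrite /adj finset.setUC. Qed.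

Lemma adjxx x : adj G x x = false.
Proof.
apply/negP; rewrite /adj finset.setUid; case: G => E /= /forallP /(_ [set x]%SET) EP.
by move=> xE; move: EP; rewrite xE cards1.
Qed.

Definition step (x y : V) : nat :=
  if x == y then 0%N else if adj G x y then 1%N else 2%N.

Fixpoint tail_len (x : V) (s : seq V) : nat :=
  if s is y :: s' then (step x y + tail_len y s')%N else 0%N.

Definition is_tail (l : nat) (x : V) (s : seq V) : bool :=
  path (fun y z => y != z) x s && (tail_len x s == l).

Lemma ohead_filter_iota (P : pred nat) (k n : nat) :
  (k < n)%N -> P k -> (forall j, (j < k)%N -> ~~ P j) ->
  ohead [seq m <- iota 0 n | P m] = Some k.
Proof.
move=> ltkn Pk minP.
have -> : n = (k + (n - k.+1).+1)%N by lia.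
rewrite iotaD filter_cat (_ : seq.filter P (iota 0 k) = [::]) ?add0n /= ?Pk //.
apply/eqP; rewrite -(negbK (_ == _)) -has_filter -all_predC.
by apply/allP => j; rewrite mem_iota => /minP.
Qed.

Lemma has_path0 x y : has_path G x y 0 = (x == y).
Proof.
apply/existsP/idP => [[t]|/eqP->]; last by exists [tuple]; rewrite /= eqxx.
by rewrite tuple0 /= => /andP[].
Qed.

Lemma has_path1 x y : has_path G x y 1 = (x != y) && adj G x y.
Proof.
apply/existsP/idP => [[t]|/andP[xy axy]].
  case/tupleP: t => z t; rewrite tuple0 /= andbT inE => /and3P[axz /eqP <- /andP[-> _]].
  by rewrite axz.
by exists [tuple y]; rewrite /= inE axy xy eqxx.
Qed.

Hypothesis common : forall u x z, exists w, [&& adj G u w, adj G x w & adj G w z].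

Lemma distE x y : Defs.dist G x y = Some (step x y).
Proof.
rewrite /Defs.dist /step; have [<-|xy] := eqVneq x y.
  apply: ohead_filter_iota => //; last by rewrite has_path0.
  by apply/card_gt0P; exists x.
have [w /and3P[_ axw awy]] := common x x y.
have xw : x != w by apply: contraTneq axw => ->; rewrite adjxx.
have wy : w != y by apply: contraTneq awy => ->; rewrite adjxx.
(* Only lengths below [#|V|] are searched, so lengths 1 and 2 require two and three distinct
   vertices. *)
case: ifP => axy; apply: ohead_filter_iota.
- by rewrite (leq_trans _ (max_card [set x; y]%SET)) // cards2 xy.
- by rewrite has_path1 xy.
- by case=> // _; rewrite has_path0.
- rewrite (leq_trans _ (max_card (mem [:: x; w; y]))) //.
  by rewrite (card_uniqP _) //= !inE negb_or xw xy wy.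
- apply/existsP; exists [tuple w; y].
  by rewrite /= !inE negb_or axw awy xw xy wy eqxx.
- by case=> [|[|]] // _; rewrite ?has_path0 ?has_path1 // axy andbF.
Qed.

Lemma is_genE l x s : is_gen G l (x :: s) = is_tail l x s.
Proof.
rewrite /is_gen /is_tail; congr (_ && _).
rewrite (_ : len_from G x s = Some (tail_len x s)) //.
by elim: s x => //= y s IHs x; rewrite distE IHs.
Qed.

Lemma smooth_midpoint x y z : x != y -> y != z ->
  (Defs.dist G x z == Defs.addo (Defs.dist G x y) (Defs.dist G y z)) = midpoint (adj G) x y z.
Proof.
rewrite !distE /= /midpoint /step => /negPf -> /negPf ->.
case: (eqVneq x z) => [<-|_]; first by rewrite andbF; do 2 case: ifP.
by do 3 case: (adj _ _ _).
Qed.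

Lemma is_tail_cons l x y s : is_tail l x (y :: s) =
  [&& x != y, (step x y <= l)%N & is_tail (l - step x y) y s].
Proof.
rewrite /is_tail /= -andbA; congr (_ && _); rewrite andbCA; congr (_ && _).
by apply/eqP/andP => [<-|[le /eqP ->]]; [rewrite leq_addr addKn | rewrite subnKC].
Qed.

(** Inserting a midpoint adds one entry and keeps the length, so [bd] respects both gradings.
    Fillings found without regard to length can thus be cut down to a single degree. *)
Lemma bd_restrict n l x c s :
  bd (adj G) x (fun r => if (size r == n) && is_tail l x r then c r else 0) s =
  if ((size s).+1 == n) && is_tail l x s then bd (adj G) x c s else 0.
Proof.
elim: s n l x c => [|z s IHs] n l x c /=; first by rewrite if_same.
rewrite (_ : bd _ z _ s = bd (adj G) z (fun r =>
    if [&& (0 < n)%N, x != z & (step x z <= l)%N] then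
      if (size r == n.-1) && is_tail (l - step x z) z r then c (z :: r) else 0
    else 0) s); last first.
  apply: eq_bd => r; rewrite is_tail_cons; case: n => [//|n] /=.
  rewrite eqSS; case: (size r == n); case: (x != z); case: (_ <= l)%N => //=.
rewrite (bd_if _ _ (fun r => if _ then _ else _)) IHs.
rewrite (_ : \sum_(y | _) _ = \sum_(y | midpoint (adj G) x y z)
    if ((size s).+2 == n) && is_tail l x (z :: s) then c [:: y, z & s] else 0).
  rewrite is_tail_cons; case: n => [|n] /=; first by rewrite big1 ?subr0 ?oppr0.
  rewrite eqSS; case: (_ == n); case: (x != z); case: (_ <= l)%N => //=; last first.
  all: rewrite ?big1_eq ?subr0 ?oppr0 //.
  by case: ifP => // _; rewrite big1_eq subr0 oppr0.
apply: eq_bigr => y /and4P[axy ayz xz axz]; rewrite !is_tail_cons.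
have xy : x != y by apply: contraTneq axy => ->; rewrite adjxx.
have yz : y != z by apply: contraTneq ayz => ->; rewrite adjxx.
rewrite /step (negPf xz) (negPf yz) (negPf xy) axy ayz (negPf axz).
rewrite /= -subnDA; congr (if _ && _ then _ else _).
by rewrite andbA; congr (_ && _); lia.
Qed.

(** This matches insertions into [s] with deletions from [r], by recursion on the first entry. The
    sign is shifted because [x] is entry 0 of the tuple, so entry [i] of [r] has index [i.+1]. *)
Lemma bd_delta x r s x0 :
  bd (adj G) x (fun q => (r == q)%:R) s =
  \sum_(0 <= i < (size r).-1 |
      midpoint (adj G) (nth x0 (x :: r) i) (nth x0 r i) (nth x0 r i.+1))
    (-1) ^+ i.+1 * (delete i r == s)%:R.
Proof.
elim: r x s => [|y r IHr] x s.
  by rewrite big_nil; case: s => [//|z s] /=; rewrite big1 ?bd0 ?subr0.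
case: s => [|z s].
  rewrite /= big_nat_cond big1 // => i /andP[/andP[_ ilt] _].
  rewrite (_ : delete i (y :: r) == [::] = false) ?mulr0 //.
  apply/negbTE; rewrite -size_eq0 /delete size_cat size_take size_drop /=; lia.
have -> : bd (adj G) x (fun q => (y :: r == q)%:R) (z :: s) =
    - (midpoint (adj G) x y z && (r == z :: s))%:R -
    (if y == z then bd (adj G) y (fun q => (r == q)%:R) s else 0).
  rewrite /=; congr (- _ - _).
    rewrite big_mkcond (bigD1 y) //= eqseq_cons eqxx /= big1 ?addr0.
      by case: midpoint.
    by move=> v vy; rewrite eqseq_cons eq_sym (negPf vy) if_same.
  have [->|yz] := eqVneq y z; first by apply: eq_bd => q; rewrite eqseq_cons eqxx.
  by rewrite -[RHS](bd0 (adj G) z s); apply: eq_bd => q; rewrite eqseq_cons (negPf yz).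
case: r IHr => [|v r] IHr.
  by rewrite big_nil IHr big_nil if_same andbF subr0 oppr0.
rewrite /= big_ltn_cond //= big_add1 /= {}IHr /=.
rewrite (_ : \sum_(0 <= i < _ | _) (-1) ^+ i.+2 * _ = - (if y == z then
    \sum_(0 <= i < size r | midpoint (adj G) (nth x0 [:: y, v & r] i)
        (nth x0 (v :: r) i) (nth x0 r i))
      (-1) ^+ i.+1 * (delete i (v :: r) == s)%:R else 0)).
  rewrite /delete /= expr1 mulN1r eqseq_cons.
  case: (eqVneq v z) => [->|_]; last by rewrite andbF oppr0 !add0r if_same.
  by case: (midpoint _ x y z); rewrite //= mulr0n oppr0 add0r.
case: (eqVneq y z) => [->|yz]; last first.
  rewrite big1 ?oppr0 // => i _.
  by rewrite /delete /= eqseq_cons (negPf yz) mulr0.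
rewrite -sumrN; apply: eq_bigr => i _.
by rewrite exprS mulN1r mulNr /delete /= eqseq_cons eqxx.
Qed.

End CommonNeighbours.

(** * Chains as coefficient functions on tails *)

Section Coefficients.
Variables (V : finType) (G : sgraph V).

Definition coef m l (c : MC G m l) (x : V) (s : seq V) : int :=
  \sum_(t : gen G m l) c t * (tval (val t) == x :: s)%:R.

Lemma coef_val m l (c : MC G m l) (t : gen G m l) x s :
  tval (val t) = x :: s -> coef c x s = c t.
Proof.
move=> tE; rewrite /coef (bigD1 t) //= tE eqxx mulr1 big1 ?addr0 // => u ut.
by rewrite -tE (inj_eq val_inj) (inj_eq val_inj) (negPf ut) mulr0.
Qed.

Lemma coef_neq0 m l (c : MC G m l) x s :
  coef c x s != 0 -> exists t : gen G m l, tval (val t) = x :: s.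
Proof.
apply: contra_neqP => noT; rewrite /coef big1 // => t _.
by case: eqP => [tE|_]; [case: noT; exists t | rewrite mulr0].
Qed.

Hypothesis common : forall u x z, exists w, [&& adj G u w, adj G x w & adj G w z].

Lemma coef_neq0_tail k l (c : MC G k.+1 l) x s :
  coef c x s != 0 -> (size s == k) && is_tail G l x s.
Proof.
move=> /coef_neq0[t tE]; rewrite -is_genE // -tE (valP t) andbT.
by have := size_tuple (val t); rewrite tE /= => -[->].
Qed.

Lemma coef_restrict k l (c : MC G k.+1 l) x :
  coef c x =1 fun s => if (size s == k) && is_tail G l x s then coef c x s else 0.
Proof. by move=> s; case: ifPn => // /(contraNeq (@coef_neq0_tail _ _ _ _ _)) ->. Qed.

Lemma boundary_gen_bd k l (u : k.+1.-tuple V) (t : gen G k l) x s :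
  is_gen G l u -> tval (val t) = x :: s ->
  boundary_gen G l u t = bd (adj G) x (fun r => (tval u == x :: r)%:R) s.
Proof.
move=> + tE; rewrite /boundary_gen sum_ffunE; set x0 := thead u; move: x0 => x0.
case: u => [[//|y r] sz_u] /= /andP[/(pathP x0) neq _].
have sz_r : size r = k by apply/eqP.
rewrite big_add1.
transitivity (\sum_(0 <= i < k.-1 |
    midpoint (adj G) (nth x0 (y :: r) i) (nth x0 r i) (nth x0 r i.+1))
    (-1) ^+ i.+1 * (y :: delete i r == x :: s)%:R : int).
  rewrite big_nat_cond [RHS]big_nat_cond; apply: eq_big => [i|i _].
    apply: andb_id2l => /andP[_ ltik] /=; rewrite smooth_midpoint //.
      by apply: neq; rewrite sz_r; lia.
    by apply: (neq i.+1); rewrite sz_r; lia.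
  by rewrite ffunMzE ffunE tE mulrzz mulrC eq_sym.
(* Entry 0 is never deleted, so both sides vanish unless the first vertices agree. *)
have [->|yx] := eqVneq y x.
  rewrite (eq_bd _ _ _ (d := fun q => (r == q)%:R)) => [|q]; last by rewrite eqseq_cons eqxx.
  rewrite -sz_r (bd_delta _ _ _ _ x0); apply: eq_bigr => i _.
  by rewrite eqseq_cons eqxx.
rewrite big1 => [|i _]; last by rewrite eqseq_cons (negPf yx) mulr0.
by rewrite -[LHS](bd0 (adj G) x s); apply: eq_bd => q; rewrite eqseq_cons (negPf yx).
Qed.

Lemma boundary_coef k l (c : MC G k.+1 l) (t : gen G k l) x s :
  tval (val t) = x :: s -> boundary c t = bd (adj G) x (coef c x) s.
Proof.
move=> tE; rewrite /boundary sum_ffunE.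
rewrite (bd_sum _ _ (fun (u : gen G k.+1 l) r => c u * (tval (val u) == x :: r)%:R)).
apply: eq_bigr => u _; rewrite ffunMzE bdZ mulrC -mulrzr intz; congr (_ * _).
exact: boundary_gen_bd (valP u) tE.
Qed.

(** The hypothesis speaks of generators only; at all other tails the value vanishes by
    [bd_restrict]. *)
Lemma boundary_eq0 k l (c : MC G k.+1 l) x s :
  boundary c = 0 -> bd (adj G) x (coef c x) s = 0.
Proof.
move=> c0; rewrite (eq_bd _ _ _ (coef_restrict c x)) bd_restrict //.
case: ifP => // /andP[/eqP sz_s s_tail].
have sz : size (x :: s) == k by rewrite /= sz_s.
have st : is_gen G l (Tuple sz) by rewrite is_genE.
by rewrite -(boundary_coef c (t := Sub (Tuple sz) st)) // c0 ffunE.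
Qed.

Lemma tail_len_path x s : path (adj G) x s -> tail_len G x s = size s.
Proof.
elim: s x => //= y s IHs x /andP[axy /IHs ->]; rewrite /step axy.
by rewrite (_ : (x == y) = false) //; apply: contraTF axy => /eqP ->; rewrite adjxx.
Qed.

Lemma cycle_is_boundary k l (c : MC G k.+1 l) :
  k <> l -> boundary c = 0 -> exists e : MC G k.+2 l, boundary e = c.
Proof.
move=> kl c_cyc.
have /choice[E EP] : forall x, exists Ex, forall s, bd (adj G) x Ex s = coef c x s.
  move=> x; have [//|||E [EP _]] := @off_diagonal_exact _ _ common k x (coef c x).
  - by move=> s; exact: boundary_eq0.
  - by move=> s /coef_neq0_tail/andP[/eqP ->].
  - move=> s /coef_neq0_tail/andP[/eqP sz /andP[-> /eqP len_s]] /=.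
    (* A tail of [k] steps along edges has length [k], so [k <> l] forces a step of length 2. *)
    by apply/negP => /tail_len_path; rewrite len_s sz => /esym.
  - by exists E.
(* The values of [E] outside the generators of this degree are dropped, which [bd_restrict]
   permits. *)
pose e : MC G k.+2 l :=
  [ffun t : gen G k.+2 l => E (thead (val t)) (behead (val t))].
have eE x : coef e x =1 fun s => if (size s == k.+1) && is_tail G l x s then E x s else 0.
  move=> s; rewrite coef_restrict; case: ifP => // /andP[sz s_tail].
  have st : is_gen G l (Tuple (sz : size (x :: s) == k.+2)) by rewrite is_genE.
  by rewrite (@coef_val _ _ e (Sub (Tuple (sz : size (x :: s) == k.+2)) st) x s) // ffunE.
exists e; apply/ffunP => t; case tE : (tval (val t)) => [|x s].
  by have := size_tuple (val t); rewrite tE.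
rewrite (boundary_coef e tE) (eq_bd _ _ _ (eE x)) bd_restrict // EP.
by rewrite -(coef_val c tE) [RHS]coef_restrict eqSS.
Qed.

Lemma common_neighbours_diagonal : diagonal_graph G.
Proof.
move=> k l kl h; elim/quotW: h => z.
have -> : 0 = (\pi_(MH G k l) 0)%qT by rewrite /MH !piE.
apply/eqP; rewrite -Quotient.idealrBE subr0.
apply/asboolP; apply: cycle_is_boundary => //.
by apply/eqP; case: z.
Qed.

End Coefficients.

(** * Common neighbours in random graphs *)

Section RandomGraph.
Variables (R : realType) (n : nat) (p : R).

Lemma er_prob_superset (A : {set {set 'I_n}}) :
  (forall e, e \in A -> #|e| = 2%N) ->
  \sum_(G : sgraph 'I_n | A \subset edges G) er_weight p G = p ^+ #|A|.
Proof.
move=> A_pairs.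
(* [F] weighs [e] as an edge and [F'] as a non-edge, with 0 on [A] to force its edges. If [e] is no
   pair, the weights 0 and 1 leave only edge sets of graphs in the expanded product. *)
pose F (e : {set 'I_n}) : R := if #|e| == 2%N then p else 0.
pose F' (e : {set 'I_n}) : R :=
  if #|e| == 2%N then (1 - p) * (e \notin A)%:R else 1.
transitivity (\prod_(e : {set 'I_n}) (F e + F' e)); last first.
  transitivity (\prod_(e in A) p); last by rewrite prodr_const.
  rewrite [RHS]big_mkcond; apply: eq_bigr => e _; rewrite /F /F'.
  case: ifPn => [_|eN2]; first by case: (e \in A) => /=; ring.
  by rewrite ifN ?add0r //; apply: contra eN2 => /A_pairs ->.
rewrite bigA_distr [RHS](bigID (fun S : {set {set 'I_n}} => [forall e in S, #|e| == 2%N])) /=.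
rewrite [X in _ = _ + X]big1 ?addr0; last first.
  move=> S /forallPn[e]; rewrite negb_imply => /andP[eS eN2].
  by rewrite (bigD1 e) //= eS /F (negPf eN2) mul0r.
(* The empty graph serves as the default value of [insubd]. *)
have G0P : [forall e in (finset.set0 : {set {set 'I_n}}), #|e| == 2%N].
  by apply/forallP => e; rewrite finset.in_set0.
pose G0 := SGraph G0P.
rewrite [RHS](reindex_onto val (insubd G0)) /=; last first.
  by move=> S S_pairs; rewrite insubdK.
rewrite big_mkcond; apply: eq_big => [G|G _].
  by rewrite valKd eqxx andbT; case: G.
transitivity (er_weight p G * (A \subset edges G)%:R).
  by case: ifP; rewrite ?mulr1 ?mulr0.
rewrite /er_weight big_mkcond /=.
have -> : (A \subset edges G)%:R = \prod_(e : {set 'I_n}) ((e \in A) ==> (e \in edges G))%:R :> R.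
  have [/fintype.subsetP AG|/fintype.subsetPn[e eA eG]] := boolP (A \subset edges G).
    by rewrite big1 // => e _; rewrite (introT implyP (AG e)).
  by rewrite (bigD1 e) //= eA (negPf eG) mul0r.
rewrite -big_split; apply: eq_bigr => e _ /=; rewrite /F /F'.
case: ifP => e2; case: ifP => eG; rewrite ?implybT ?implybF ?mulr1 ?mul1r //.
  by case: G eG => S /= /forallP /(_ e) /implyP + eS; rewrite e2 => /(_ eS).
have -> : (e \in A) = false by apply: contraFF e2 => /A_pairs ->.
by [].
Qed.

Lemma er_weight_ge0 (G : sgraph 'I_n) : 0 <= p <= 1 -> 0 <= er_weight p G.
Proof.
by move=> /andP[p0 p1]; apply: prodr_ge0 => e _; case: ifP; rewrite ?subr_ge0.
Qed.

Lemma er_weight_sum : \sum_(G : sgraph 'I_n) er_weight p G = 1.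
Proof.
rewrite -[RHS](expr0 p) -(cards0 ({set 'I_n} : finType)) -er_prob_superset => [|e]; last by rewrite inE.
by apply: eq_bigl => G; rewrite finset.sub0set.
Qed.

(* Inclusion-exclusion over the set J of the common neighbours of A: the edges
   between J and A are #|J| * #|A| distinct ones. *)
Lemma er_no_common_neighbour (A : {set 'I_n}) :
  \sum_(G : sgraph 'I_n) er_weight p G *
    \prod_(w in ~: A) (1 - [forall b in A, adj G w b]%:R) =
  (1 - p ^+ #|A|) ^+ (n - #|A|).
Proof.
(* The value 0 on [A] lets the product run over all vertices, and only sets [J] disjoint from [A]
   survive in its expansion. *)
pose f (q : 'I_n -> R) w := if w \in A then 0 else - q w.
have expand (q : 'I_n -> R) : \prod_(w in ~: A) (1 - q w) =
    \sum_(J : {set 'I_n}) \prod_w (if w \in J then f q w else 1).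
  rewrite -(bigA_distr _ _ (f q) (fun=> 1)) big_mkcond; apply: eq_bigr => w _.
  by rewrite /f inE; case: (w \in A); rewrite /= ?add0r // addrC.
(* Both sides are expanded by [expand], with a constant [q] on the right, and compared for each
   [J]. *)
transitivity (\prod_(w in ~: A) (1 - p ^+ #|A|)); last first.
  by rewrite prodr_const (cardsCs (~: A)) finset.setCK card_ord.
rewrite expand.
under eq_bigr => G _ do rewrite expand mulr_sumr.
rewrite exchange_big; apply: eq_bigr => J _.
have prodJ (q : 'I_n -> R) : \prod_w (if w \in J then f q w else 1) =
    if [disjoint J & A] then (-1) ^+ #|J| * \prod_(w in J) q w else 0.
  rewrite -big_mkcond /=; case: ifPn => [JA|/pred0Pn[w /andP[/= wJ wA]]].
    by rewrite -prodrN; apply: eq_bigr => w wJ; rewrite /f (disjointFr JA wJ).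
  by rewrite (bigD1 w) //= /f wA mul0r.
rewrite prodJ; under eq_bigr => G _ do rewrite prodJ.
case: ifP => [JA|_]; last by rewrite big1 // => G _; rewrite mulr0.
pose S : {set {set 'I_n}} := [set [set u.1; u.2]%SET | u in finset.setX J A]%SET.
have S_card : #|S| = (#|J| * #|A|)%N.
  rewrite -cardsX card_in_imset // => -[w b] [w' b'] /setXP[wJ bA] /setXP[w'J b'A] /= /setP E.
  congr pair.
    have := E w; rewrite !inE eqxx /= => /esym/orP[/eqP//|/eqP wb'].
    by have := disjointFr JA wJ; rewrite wb' b'A.
  have := E b; rewrite !inE eqxx orbT => /esym/orP[/eqP bw'|/eqP//].
  by have := disjointFl JA bA; rewrite bw' w'J.
transitivity ((-1) ^+ #|J| * \sum_(G : sgraph 'I_n | S \subset edges G) er_weight p G).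
  rewrite mulr_sumr [RHS]big_mkcond /=; apply: eq_bigr => G _.
  rewrite mulrCA; case: ifPn => [/fintype.subsetP SG|].
    congr (_ * _); rewrite big1 ?mulr1 // => w wJ.
    rewrite (_ : [forall b in A, adj G w b]) //; apply/forallP => b; apply/implyP => bA.
    by apply: SG; apply/imsetP; exists (w, b); rewrite ?inE ?wJ.
  move=> /fintype.subsetPn[e /imsetP[[w b] /setXP[/= wJ bA] ->] wbG].
  rewrite (bigD1 w) //= (_ : [forall b in A, adj G w b] = false) ?mul0r ?mulr0 //.
  by apply/negbTE/forallPn; exists b; rewrite bA.
rewrite er_prob_superset => [|e /imsetP[[w b] /setXP[/= wJ bA] ->]].
  by rewrite prodr_const S_card mulnC exprM.
rewrite cards2; case: eqVneq => [wb|//].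
by have := disjointFr JA wJ; rewrite wb bA.
Qed.

Lemma er_prob_diagonal_ge : 0 <= p <= 1 -> (3 <= n)%N ->
  1 - n%:R ^+ 3 * (1 - p ^+ 3) ^+ (n - 3) <= er_prob p (@diagonal_graph 'I_n).
Proof.
move=> p01 n3; have /andP[p0 p1] := p01.
pose triple (t : 'I_n * 'I_n * 'I_n) : {set 'I_n} := [set t.1.1; t.1.2; t.2]%SET.
pose bad t (G : sgraph 'I_n) := [forall w, ~~ [forall b in triple t, adj G w b]].
have bad_le t : \sum_(G | bad t G) er_weight p G <= (1 - p ^+ 3) ^+ (n - 3).
  (* Repeated vertices make the triple smaller, but (1 - p^m)^(n - m) does not decrease in m, so m =
     3 is the worst case. *)
  have t3 : (#|triple t| <= 3)%N.
    by rewrite /triple -finset.setUA !finset.cardsU1 cards1; do 2 case: (_ \notin _).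
  apply: (@le_trans _ _ ((1 - p ^+ #|triple t|) ^+ (n - #|triple t|))).
    (* The product over [w] is 1 for a bad graph and nonnegative for every other graph. *)
    rewrite -er_no_common_neighbour big_mkcond; apply: ler_sum => G _.
    case: ifP => [/forallP badG|_].
      by rewrite big1 ?mulr1 // => w _; rewrite (negPf (badG w)) subr0.
    apply: mulr_ge0; first exact: er_weight_ge0.
    by apply: prodr_ge0 => w _; case: [forall b in _, _]; rewrite ?subrr ?subr0.
  have pt : p ^+ 3 <= p ^+ #|triple t| by apply: ler_wiXn2l.
  have pt1 : p ^+ #|triple t| <= 1 by apply: exprn_ile1.
  apply: (@le_trans _ _ ((1 - p ^+ 3) ^+ (n - #|triple t|))).
    by apply: lerXn2r; rewrite ?nnegrE; lra.
  apply: ler_wiXn2l; [lra| |lia].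
  by rewrite gerBl exprn_ge0.
rewrite lerBlDr -[leLHS]er_weight_sum /er_prob (bigID (fun G => `[< diagonal_graph G >])) /=.
rewrite lerD2l.
apply: (@le_trans _ _ (\sum_t \sum_(G | bad t G) er_weight p G)); last first.
  apply: (@le_trans _ _ (\sum_(t : 'I_n * 'I_n * 'I_n) (1 - p ^+ 3) ^+ (n - 3))).
    by apply: ler_sum => t _; exact: bad_le.
  by rewrite sumr_const !card_prod card_ord -[leLHS]mulr_natl !natrM (exprS n%:R) expr2 mulrA.
rewrite (exchange_big_dep predT) //= big_mkcond; apply: ler_sum => G _.
have wG := er_weight_ge0 G p01.
case: ifPn => [/asboolPn Gnd|_]; last by apply: sumr_ge0.
have [t badt] : exists t, bad t G.
  apply/existsP; apply: contra_notT Gnd => /existsPn good.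
  apply: common_neighbours_diagonal => u x z.
  have /forallPn[w] := good (u, x, z); rewrite negbK => /forallP wP.
  exists w; rewrite adjC (adjC G x).
  by rewrite !(implyP (wP _)) // !inE eqxx ?orbT.
by rewrite (bigD1 t) //= lerDl sumr_ge0.
Qed.

End RandomGraph.

(** * Asymptotics of the union bound *)

(** By 1 - t <= exp(-t), the left side is at most exp(3 ln n - q^3 (n - 3)), with exponent at most
    -eps ln n + (3 (3 + eps) / n) ln n. The lower bound on [n] makes the last coefficient at most
    eps / 2. *)
Lemma union_bound_le (R : realType) (eps q : R) (n : nat) :
  0 < eps -> 0 <= q <= 1 -> (3 <= n)%N -> 6 * (3 + eps) / eps <= n%:R ->
  ((3 + eps) * ln n%:R / n%:R) `^ (1 / 3) <= q ->
  n%:R ^+ 3 * (1 - q ^+ 3) ^+ (n - 3) <= expR (- (eps / 2 * ln n%:R)).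
Proof.
move=> eps0 /andP[q0 q1] n3 n_big q_ge.
have n0 : 0 < n%:R :> R by rewrite ltr0n; lia.
have L0 : 0 <= ln n%:R :> R by rewrite ln_ge0 // ler1n; lia.
have q3_ge : (3 + eps) * ln n%:R / n%:R <= q ^+ 3.
  have B0 : 0 <= (3 + eps) * ln n%:R / n%:R.
    by rewrite divr_ge0 ?mulr_ge0 ?(ltW n0) //; lra.
  apply: le_trans (lerXn2r 3 _ _ q_ge); rewrite ?nnegrE ?powR_ge0 //.
  by rewrite -powR_mulrn ?powR_ge0 // -powRrM (_ : 1 / 3 * 3%:R = 1) ?powRr1 //; field.
have q3_le1 : q ^+ 3 <= 1 by rewrite exprn_ile1.
apply: (@le_trans _ _ (expR (3 * ln n%:R - q ^+ 3 * (n - 3)%:R))).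
  rewrite expRD (mulrC 3) -(mulNr _ (n - 3)%:R) !expRM_natr lnK ?posrE //.
  rewrite ler_pM2l ?exprn_gt0 // lerXn2r ?nnegrE ?expR_ge0 //; first lra.
  by have := expR_ge1Dx (- q ^+ 3); lra.
rewrite ler_expR natrB // lerNr opprB.
set L := ln n%:R in L0 q3_ge *; set N := n%:R in n0 n_big q3_ge *.
have N3 : 0 <= N - 3 by rewrite subr_ge0 /N ler_nat.
have step1 : (3 + eps) * L / N * (N - 3) <= q ^+ 3 * (N - 3) by rewrite ler_wpM2r.
have n_big' : 6 * (3 + eps) <= N * eps by rewrite -ler_pdivrMr.
have inv : 3 * (3 + eps) / N <= eps / 2 by rewrite ler_pdivrMr //; lra.
have eq1 : (3 + eps) * L / N * (N - 3) = (3 + eps) * L - 3 * (3 + eps) / N * L.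
  by field; rewrite gt_eqF.
have := ler_wpM2r L0 inv; lra.
Qed.

Theorem theorem1p8 (R : realType) (eps : R) (p : nat -> R)
    (eps_gt0 : 0 < eps)
    (p01 : forall n : nat, 0 <= p n <= 1)
    (p_ge : \forall n \near \oo,
       ((3 + eps) * ln n%:R / n%:R) `^ (1 / 3) <= p n) :
  er_prob (p n) (@diagonal_graph 'I_n) @[n --> \oo] --> (1 : R).
Proof.
apply/cvgrPdist_le => d d0; near=> n.
have n3 : (3 <= n)%N by near: n; exact: nbhs_infty_ge.
have le1 : er_prob (p n) (@diagonal_graph 'I_n) <= 1.
  rewrite -(er_weight_sum n (p n)) /er_prob big_mkcond; apply: ler_sum => G _.
  by case: ifP => // _; exact: er_weight_ge0.
rewrite ger0_norm ?subr_ge0 // lerBlDr -lerBlDl.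
apply: le_trans (er_prob_diagonal_ge (p01 n) n3); rewrite lerD2l lerN2.
apply: le_trans (union_bound_le eps_gt0 (p01 n) n3 _ _) _.
- by near: n; exact: nbhs_infty_ger.
- by near: n.
(* The bound drops below [d] once ln n >= (eps / 2)^-1 (- ln d), which becomes a lower bound on [n]
   after exponentiation. *)
rewrite -[leRHS]lnK ?posrE // ler_expR lerNl -ler_pdivrMl ?divr_gt0 //.
rewrite -ler_expR lnK ?posrE ?ltr0n; last lia.
by near: n; exact: nbhs_infty_ger.
Unshelve. all: by end_near.
Qed.
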